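(* Let $0<\mu<b$, $d>0$ and $\beta$ be such that $\mathcal{P}_{(\mu,b,d,\beta)}$ is nonempty (which forces $0<\beta<1$), and put $$\tau_1=\mu-\frac{d}{2(1-\beta)},\qquad \tau_2=\mu+\frac{d}{2\beta}.$$ Then for all $t\in[0,b]$ $$\sup_{\mathbb{P}\in\mathcal{P}_{(\mu,b,d,\beta)}}\mathbb{P}(X\ge t)=\begin{cases}1, & t\in[0,\tau_1],\\ \frac{(1-\beta)\mu+\beta t}{t}-\frac{d}{2t}, & t\in[\tau_1,\mu),\\ \beta, & t\in[\mu,\tau_2],\\ \frac{d}{2(t-\mu)}, & t\in[\tau_2,b],\end{cases}$$ where at points belonging to several intervals the first applicable case is used.
   Context: $\mathcal{P}_{(\mu,b,d,\beta)}$ is the set of all Borel probability measures $\mathbb{P}$ (the distribution of a real random variable $X$) such that $\mathbb{P}(X\in[0,b])=1$, $\mathbb{E}_{\mathbb{P}}[X]=\mu$, $\mathbb{E}_{\mathbb{P}}[|X-\mu|]=d$ and $\mathbb{P}(X\ge\mu)=\beta$. *)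

(* Defs.v *)
From HB Require Import structures.
From mathcomp Require Import all_boot all_order all_algebra.
From mathcomp Require Import all_classical all_reals all_analysis.

Set Implicit Arguments.
Unset Strict Implicit.
Unset Printing Implicit Defensive.

Import Order.TTheory GRing.Theory Num.Theory.
Import numFieldNormedType.Exports.

Local Open Scope classical_set_scope.
Local Open Scope ring_scope.

(* A law P is a Borel probability measure on the line; X is the identity
   random variable. *)
Definition ambiguity_set (R : realType) (mu b d beta : R) :
    set (probability (measurableTypeR R) R) :=
  [set P : probability (measurableTypeR R) R |
    [/\ P `[0, b]%classic = 1%E,
        'E_P[fun x => x]%E = mu%:E,
        'E_P[fun x => `|x - mu|%R]%E = d%:E &
        P `[mu, +oo[%classic = beta%:E]].

Definition tau1 (R : realType) (mu d beta : R) : R :=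
  mu - d / (2 * (1 - beta)).

Definition tau2 (R : realType) (mu d beta : R) : R :=
  mu + d / (2 * beta).

(* At a common endpoint of two cases the first one applies. *)
Definition tail_bound (R : realType) (mu d beta t : R) : R :=
  if t <= tau1 mu d beta then 1
  else if t < mu then ((1 - beta) * mu + beta * t) / t - d / (2 * t)
  else if t <= tau2 mu d beta then beta
  else d / (2 * (t - mu)).

(* Main.v *)
Require Import Defs.
From HB Require Import structures.
From mathcomp Require Import all_boot all_order all_algebra.
From mathcomp Require Import all_classical all_reals all_analysis.
From mathcomp Require Import measurable_realfun lra ring.

Set Implicit Arguments.
Unset Strict Implicit.
Unset Printing Implicit Defensive.

Import Order.TTheory GRing.Theory Num.Theory.
Import numFieldNormedType.Exports.

Local Open Scope classical_set_scope.
Local Open Scope ring_scope.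

(** The theorem is linear programming duality for a moment problem.

    Upper bounds. For a law P in the ambiguity set, the integrals of
    1, x, |x - mu| and 1[x >= mu] are the prescribed numbers 1, mu, d and beta.
    A linear combination g of these four functions therefore has an integral
    that depends on the data only, and if 1[x >= t] <= g(x) on [0, b], then that
    integral bounds P(X >= t) (weak_duality). Since
    (x - mu)^+ = (|x - mu| + (x - mu)) / 2 and
    x 1[x < mu] = (mu + x - |x - mu|) / 2 - mu 1[x >= mu],
    both lie in the span, the following dual functions are available:
    - for t < mu, g(x) = 1[x >= mu] + (x / t) 1[x < mu]  (tail_le_below);
    - for t >= mu, g(x) = 1[x >= mu]  (tail_le_beta);
    - for t > mu, g(x) = (x - mu)^+ / (t - mu), which is Markov's inequality
      for the positive part  (tail_le_above).

    Attainment. The mean and the mean absolute deviation fix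
    E(X - mu)^+ = E(mu - X)^+ = d / 2. The points tau1 and tau2 are the
    conditional means of X below mu and from mu on, so collapsing each side to
    its mean gives a feasible law with two atoms; it attains 1 for t <= tau1
    and beta for mu <= t <= tau2. If tau1 < t < mu, the part below mu is split over the
    zeros 0 and t of g(x) - 1[x >= t] in [0, mu); if t > tau2, the part above
    is split over its zeros mu and t (below_attainer, above_attainer). These
    laws live on [0, b] because 0 <= tau1 and tau2 <= b, and this is a
    consequence of nonemptiness: weak duality for the functions
    x 1[x < mu] >= 0 and (b - mu) 1[x >= mu] - (x - mu)^+ >= 0 gives
    d / 2 <= mu (1 - beta) and d / 2 <= (b - mu) beta. These two inequalities
    also force 0 < beta < 1. *)

(** * Tail indicators *)

Definition tail_indicator (R : realType) (t x : R) : R := (t <= x)%R%:R.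

Lemma indic_tail (R : realType) (t : R) :
  \1_(`[t, +oo[%classic) = tail_indicator t :> (R -> R).
Proof.
by apply/funext => x; rewrite indicE /tail_indicator mem_setE in_itv /= andbT.
Qed.

Lemma tail_indicator1 (R : realType) (t x : R) : t <= x -> tail_indicator t x = 1.
Proof. by rewrite /tail_indicator => ->. Qed.

Lemma tail_indicator0 (R : realType) (t x : R) : x < t -> tail_indicator t x = 0.
Proof. by rewrite /tail_indicator leNgt => ->. Qed.

(** * Weak duality *)

Section dual.
Variables (R : realType) (mu b d beta : R).
Variable P : probability (measurableTypeR R) R.
Hypothesis HP : ambiguity_set mu b d beta P.

Lemma integrable_abs_dev : P.-integrable setT (EFin \o (fun x : R => `|x - mu|)).
Proof.
case: HP => _ _ Ed _; apply/integrableP; split.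
  do 2 apply: measurableT_comp => //; apply/measurable_EFinP.
  by apply: measurableT_comp => //; exact: measurable_funB.
under eq_integral => x _ do rewrite /= normr_id.
by move: Ed; rewrite unlock => ->; rewrite ltry.
Qed.

(** The factor s makes the lemma serve two purposes: with s > 0 it bounds tail
    probabilities without division by t or t - mu, and with s = 0 it yields the
    inequalities between the data that a nonempty ambiguity set entails. The
    domination is needed on [0, b] only, as P vanishes outside. *)
Lemma weak_duality (a c e f s t : R) :
  (forall x, 0 <= x <= b ->
    s * tail_indicator t x <=
      a + c * x + e * `|x - mu| + f * tail_indicator mu x) ->
  s * fine (P `[t, +oo[%classic) <= a + c * mu + e * d + f * beta.
Proof.
move=> dom; have [P0b EX Ed Pmu] := HP.
have L1 : cst 1 \in Lfun P 1 by exact: Lfun_cst.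
have Ld : (fun x : R => `|x - mu|) \in Lfun P 1.
  by apply/Lfun1_integrable; exact: integrable_abs_dev.
(* The finite absolute deviation makes the mean finite as well. *)
have LX : (fun x : R => x) \in Lfun P 1.
  apply/Lfun1_integrable.
  apply: (le_integrable measurableT _ _ (integrableD measurableT integrable_abs_dev
    (finite_measure_integrable_cst P `|mu| measurableT))).
    by apply/measurable_EFinP; exact: measurable_id.
  move=> x _ /=; rewrite lee_fin [leRHS]ger0_norm ?addr_ge0//.
  by rewrite -[x in leLHS](subrK mu) ler_normD.
have Li r : (fun x : R => tail_indicator r x) \in Lfun P 1.
  by apply/Lfun1_integrable; rewrite -indic_tail; exact: integrable_indic.
have Ei r : 'E_P[fun x : R => tail_indicator r x]%E = P `[r, +oo[%classic.
  by rewrite -indic_tail expectation_indic.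
(* The slack of the domination: its expectation is the claimed difference, and
   it is nonnegative on a set of full measure. *)
pose hs : seq (R -> R) := [:: a \o* cst 1; c \o* (fun x : R => x);
  e \o* (fun x : R => `|x - mu|); f \o* tail_indicator mu; (- s) \o* tail_indicator t].
pose h := \sum_(X <- hs) X.
have Lhs X : X \in hs -> X \in Lfun P 1.
  by rewrite !inE => /or4P[|||/orP[]] /eqP->; exact: Lfun_scale.
have hE x : h x = a + c * x + e * `|x - mu| + f * tail_indicator mu x -
    s * tail_indicator t x.
  by rewrite /h /hs !big_cons big_nil addr0 !fctE /=; ring.
have Eh : 'E_P[h]%E =
    ((a + c * mu + e * d + f * beta)%:E - s%:E * P `[t, +oo[%classic)%E.
  rewrite /h expectation_sum// /hs !big_cons big_nil !expectationZl//.
  rewrite expectation_cst EX Ed !Ei Pmu adde0 mule1 -!EFinM EFinN mulNe.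
  by rewrite !addeA -!EFinD.
have mh : P.-integrable setT (EFin \o h).
  by apply/Lfun1_integrable; rewrite /h big_seq rpred_sum.
have h_ge0 : (0 <= 'E_P[h])%E.
  rewrite unlock (@negligible_integral _ _ _ P setT (~` `[0, b]%classic)) //=.
  - rewrite setTD setCK; apply: integral_ge0 => x /=; rewrite in_itv/= => x0b.
    by rewrite lee_fin hE subr_ge0; exact: dom.
  - exact: measurableC.
  - by rewrite probability_setC// P0b subee.
have finPt : P `[t, +oo[%classic \is a fin_num by exact: fin_num_measure.
by move: h_ge0; rewrite Eh sube_ge0 ?fin_numM// -(fineK finPt) lee_fin.
Qed.
End dual.

(** * Dual functions *)

(** Dual function x 1[x < mu], nonnegative on [0, b]. *)
Lemma half_dev_le_below (R : realType) (mu b d beta : R) P :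
  ambiguity_set mu b d beta P -> d / 2 <= mu * (1 - beta).
Proof.
move=> HP.
have := @weak_duality _ _ _ _ _ _ HP (mu / 2) (1 / 2) (- (1 / 2)) (- mu) 0 0 _.
rewrite mul0r => H; suff: 0 <= mu / 2 + 1 / 2 * mu + - (1 / 2) * d + - mu * beta by lra.
apply: H => x /andP[x0 xb]; rewrite mul0r.
have [mux|xmu] := lerP mu x.
  by rewrite (tail_indicator1 mux); lra.
by rewrite (tail_indicator0 xmu); lra.
Qed.

(** Dual function (b - mu) 1[x >= mu] - (x - mu)^+, nonnegative up to b. *)
Lemma half_dev_le_above (R : realType) (mu b d beta : R) P :
  ambiguity_set mu b d beta P -> d / 2 <= (b - mu) * beta.
Proof.
move=> HP.
have := @weak_duality _ _ _ _ _ _ HP (mu / 2) (- (1 / 2)) (- (1 / 2)) (b - mu) 0 0 _.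
rewrite mul0r => H.
suff: 0 <= mu / 2 + - (1 / 2) * mu + - (1 / 2) * d + (b - mu) * beta by lra.
apply: H => x /andP[x0 xb]; rewrite mul0r.
have [mux|xmu] := lerP mu x.
  by rewrite (tail_indicator1 mux); lra.
by rewrite (tail_indicator0 xmu); lra.
Qed.

(** Dual function t 1[x >= mu] + x 1[x < mu], which dominates t 1[x >= t] on
    [0, b]. *)
Lemma tail_le_below (R : realType) (mu b d beta t : R) P :
  ambiguity_set mu b d beta P -> 0 < t <= mu ->
  t * fine (P `[t, +oo[%classic) <= (1 - beta) * mu + beta * t - d / 2.
Proof.
move=> HP /andP[t0 tmu].
apply: (@le_trans _ _ (mu / 2 + 1 / 2 * mu + - (1 / 2) * d + (t - mu) * beta)); last lra.
apply: (weak_duality HP) => x /andP[x0 xb].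
have [mux|xmu] := lerP mu x.
  by rewrite (tail_indicator1 mux) (tail_indicator1 (le_trans tmu mux)); lra.
rewrite (tail_indicator0 xmu).
by have [tx|xt] := lerP t x; rewrite ?(tail_indicator1 tx) ?(tail_indicator0 xt); lra.
Qed.

(** Markov's inequality for (X - mu)^+, whose mean is d / 2. *)
Lemma tail_le_above (R : realType) (mu b d beta t : R) P :
  ambiguity_set mu b d beta P -> mu <= t ->
  (t - mu) * fine (P `[t, +oo[%classic) <= d / 2.
Proof.
move=> HP mut.
apply: (@le_trans _ _ (- (mu / 2) + 1 / 2 * mu + 1 / 2 * d + 0 * beta)); last lra.
apply: (weak_duality HP) => x /andP[x0 xb].
have [mux|xmu] := lerP mu x.
  by have [tx|xt] := lerP t x; rewrite ?(tail_indicator1 tx) ?(tail_indicator0 xt); lra.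
by rewrite (tail_indicator0 (lt_le_trans xmu mut)); lra.
Qed.

Lemma tail_le_beta (R : realType) (mu b d beta t : R) P :
  ambiguity_set mu b d beta P -> mu <= t ->
  fine (P `[t, +oo[%classic) <= beta.
Proof.
move=> [_ _ _ Pmu] mut.
rewrite -lee_fin fineK ?fin_num_measure// -Pmu.
apply: le_measure; rewrite ?inE//.
by apply: subset_itvr; rewrite bnd_simp.
Qed.

(** * Laws with finitely many atoms *)

Lemma finite_law_exists d (T : measurableType d) (R : realType) n
    (p : nat -> R) (x : nat -> T) :
  (forall k, 0 <= p k) -> \sum_(k < n) p k = 1 ->
  exists P : probability T R,
    (forall A, measurable A -> P A = (\sum_(k < n) p k * \1_A (x k))%:E) /\
    (forall f : T -> R, measurable_fun [set: T] f ->
      'E_P[f]%E = (\sum_(k < n) p k * f (x k))%:E).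
Proof.
move=> p_ge0 sum_p.
pose m_ k : {measure set T -> \bar R} := mscale (NngNum (p_ge0 k)) (\d_(x k)).
have m_setT : msum m_ n [set: T] = 1%E.
  rewrite /msum -[1%E]/(1%:E) -sum_p -sumEFin; apply: eq_bigr => k _.
  by rewrite /= /mscale /= diracT mule1.
pose P : probability T R :=
  HB.pack (msum m_ n) (Measure_isProbability.Build _ _ _ (msum m_ n) m_setT).
exists P; split=> [A mA|f mf].
  rewrite -sumEFin; apply: eq_bigr => k _.
  by rewrite /= /mscale /= diracE indicE EFinM.
have ge0_E (g : T -> \bar R) : (forall t, 0 <= g t)%E ->
    measurable_fun [set: T] g ->
    (\int[P]_t g t = \sum_(k < n) (p k)%:E * g (x k))%E.
  move=> g0 mg; rewrite ge0_integral_measure_sum//.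
  apply: eq_bigr => k _; rewrite ge0_integral_mscale//.
  by rewrite integral_dirac// diracT mul1e.
have mEf : measurable_fun [set: T] (EFin \o f) by exact/measurable_EFinP.
(* Integration against a finite sum of measures is additive for nonnegative
   functions, hence the detour through positive and negative parts. *)
rewrite unlock -[X in integral _ _ X]/(EFin \o f) integralE.
rewrite ge0_E//; last exact/measurable_funepos.
rewrite ge0_E//; last exact/measurable_funeneg.
rewrite funerpos funerneg /= !sumEFin -EFinB -sumrB.
congr (_%:E); apply: eq_bigr => k _.
by rewrite -mulrBr -[in RHS](funrposBneg f).
Qed.

(** One law is produced for all t at once, because the two-point law is used
    at several thresholds. *)
Lemma three_point_law (R : realType) (mu b d beta p q r x y z : R) :
  0 <= p -> 0 <= q -> 0 <= r -> p + q + r = 1 ->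
  0 <= x <= b -> 0 <= y <= b -> 0 <= z <= b ->
  p * x + q * y + r * z = mu ->
  p * `|x - mu| + q * `|y - mu| + r * `|z - mu| = d ->
  p * tail_indicator mu x + q * tail_indicator mu y +
    r * tail_indicator mu z = beta ->
  exists2 P, ambiguity_set mu b d beta P & forall t,
    P `[t, +oo[%classic = (p * tail_indicator t x + q * tail_indicator t y +
      r * tail_indicator t z)%:E.
Proof.
move=> p0 q0 r0 pqr x0b y0b z0b EX Ed Ebeta.
pose w k := nth 0 [:: p; q; r] k; pose u k := nth 0 [:: x; y; z] k.
have w_ge0 k : 0 <= w k by case: k => [|[|[|k]]] //=; rewrite /w /= nth_nil.
have [||P [PE EE]] := @finite_law_exists _ (measurableTypeR R) R 3 w u => //.
  by rewrite !big_ord_recr big_ord0 /= add0r.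
have tailE t : P `[t, +oo[%classic =
    (p * tail_indicator t x + q * tail_indicator t y + r * tail_indicator t z)%:E.
  by rewrite PE// !big_ord_recr big_ord0 /= add0r !indic_tail.
exists P => //; split.
- rewrite PE// !big_ord_recr big_ord0 /= add0r !indicE !mem_setE !in_itv /=.
  by rewrite x0b y0b z0b !mulr1 pqr.
- rewrite EE; last exact: measurable_id.
  by rewrite !big_ord_recr big_ord0 /= add0r EX.
- rewrite EE; last by apply: measurableT_comp => //; exact: measurable_funB.
  by rewrite !big_ord_recr big_ord0 /= add0r Ed.
- by rewrite tailE Ebeta.
Qed.

(** * Extremal laws *)

(** The equation says that an atom of mass 1 - beta at tau1 accounts for the
    whole of E(mu - X)^+ = d / 2. *)
Lemma tau1_spec (R : realType) (mu d beta : R) :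
  0 < d -> beta < 1 -> d / 2 <= mu * (1 - beta) ->
  (1 - beta) * (mu - tau1 mu d beta) = d / 2 /\ 0 <= tau1 mu d beta < mu.
Proof.
move=> d_gt0 beta_lt1 below.
have t1E : (1 - beta) * (mu - tau1 mu d beta) = d / 2.
  by rewrite /tau1; field; rewrite subr_eq0 gt_eqF.
by split=> //; move: (tau1 _ _ _) t1E => t1 t1E; apply/andP; split; nra.
Qed.

(** An atom of mass beta at tau2 accounts for the whole of
    E(X - mu)^+ = d / 2. *)
Lemma tau2_spec (R : realType) (mu b d beta : R) :
  0 < d -> 0 < beta -> d / 2 <= (b - mu) * beta ->
  beta * (tau2 mu d beta - mu) = d / 2 /\ mu < tau2 mu d beta <= b.
Proof.
move=> d_gt0 beta_gt0 above.
have t2E : beta * (tau2 mu d beta - mu) = d / 2.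
  by rewrite /tau2; field; rewrite gt_eqF.
by split=> //; move: (tau2 _ _ _) t2E => t2 t2E; apply/andP; split; nra.
Qed.

(** The law that concentrates each side of mu at its conditional mean. *)
Lemma two_point_attainer (R : realType) (mu b d beta t1 t2 : R) :
  0 < beta < 1 -> 0 <= t1 < mu -> mu < t2 <= b ->
  (1 - beta) * (mu - t1) = d / 2 -> beta * (t2 - mu) = d / 2 ->
  exists2 P, ambiguity_set mu b d beta P & forall t,
    P `[t, +oo[%classic =
      ((1 - beta) * tail_indicator t t1 + beta * tail_indicator t t2)%:E.
Proof.
move=> /andP[beta_gt0 beta_lt1] /andP[t1_ge0 t1_lt_mu] /andP[mu_lt_t2 t2_le_b].
move=> t1E t2E.
(* Two atoms suffice here: the third one is given mass 0. *)
have [||||||||||P HP PE] :=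
    @three_point_law R mu b d beta (1 - beta) beta 0 t1 t2 t2; try lra.
- by rewrite ltr0_norm ?subr_lt0// ger0_norm ?subr_ge0 ?ltW//; lra.
- by rewrite (tail_indicator0 t1_lt_mu) (tail_indicator1 (ltW mu_lt_t2)); lra.
by exists P => // t; rewrite PE mul0r addr0.
Qed.

(** Moving the lower atom t1 apart into 0 and t keeps E(mu - X)^+. The mass at t
    is v - beta, where v is the asserted tail probability; it is nonnegative
    because t1 >= 0, and the mass 1 - v left at 0 is nonnegative because
    t > t1. *)
Lemma below_attainer (R : realType) (mu b d beta t1 t2 t : R) :
  0 < beta < 1 -> 0 <= t1 < mu -> mu < t2 <= b ->
  (1 - beta) * (mu - t1) = d / 2 -> beta * (t2 - mu) = d / 2 ->
  t1 < t < mu ->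
  exists2 P, ambiguity_set mu b d beta P &
    P `[t, +oo[%classic = (((1 - beta) * mu + beta * t) / t - d / (2 * t))%:E.
Proof.
move=> /andP[beta_gt0 beta_lt1] /andP[t1_ge0 t1_lt_mu] /andP[mu_lt_t2 t2_le_b].
move=> t1E t2E /andP[t1_lt_t t_lt_mu].
have t_gt0 : 0 < t by lra.
have mu_gt0 : 0 < mu by lra.
set v := _ - _.
have vE : t * v = (1 - beta) * mu + beta * t - d / 2.
  by rewrite /v; field; rewrite gt_eqF.
clearbody v.
have [||||||||||P HP PE] :=
    @three_point_law R mu b d beta (1 - v) (v - beta) beta 0 t t2; try lra.
- by nra.
- by nra.
- rewrite ltr0_norm ?subr_lt0// ltr0_norm ?subr_lt0//.
  by rewrite ger0_norm ?subr_ge0 ?ltW//; lra.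
- rewrite (tail_indicator0 mu_gt0) (tail_indicator0 t_lt_mu).
  by rewrite (tail_indicator1 (ltW mu_lt_t2)); lra.
exists P => //; rewrite PE (tail_indicator0 t_gt0) (tail_indicator1 (lexx t)).
by rewrite (tail_indicator1 (ltW (lt_trans t_lt_mu mu_lt_t2))); congr EFin; lra.
Qed.

(** Moving the upper atom t2 apart into mu and t keeps E(X - mu)^+ = d / 2, to
    which only t contributes; so t carries the mass v = d / (2 (t - mu)). It is
    at most beta because t > t2. *)
Lemma above_attainer (R : realType) (mu b d beta t1 t2 t : R) :
  0 < d -> 0 < beta < 1 -> 0 <= t1 < mu -> mu < t2 <= b ->
  (1 - beta) * (mu - t1) = d / 2 -> beta * (t2 - mu) = d / 2 ->
  t2 < t <= b ->
  exists2 P, ambiguity_set mu b d beta P &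
    P `[t, +oo[%classic = (d / (2 * (t - mu)))%:E.
Proof.
move=> d_gt0 /andP[beta_gt0 beta_lt1] /andP[t1_ge0 t1_lt_mu].
move=> /andP[mu_lt_t2 t2_le_b] t1E t2E /andP[t2_lt_t t_le_b].
have mu_lt_t : mu < t by lra.
set v := _ / _.
have vE : (t - mu) * v = d / 2.
  by rewrite /v; field; rewrite subr_eq0 gt_eqF.
clearbody v.
have [||||||||||P HP PE] :=
    @three_point_law R mu b d beta (1 - beta) (beta - v) v t1 mu t; try lra.
- by nra.
- by nra.
- rewrite ltr0_norm ?subr_lt0// subrr normr0 ger0_norm ?subr_ge0 ?ltW//; lra.
- rewrite (tail_indicator0 t1_lt_mu) (tail_indicator1 (lexx mu)).
  by rewrite (tail_indicator1 (ltW mu_lt_t)); lra.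
exists P => //; rewrite PE (tail_indicator0 (lt_trans t1_lt_mu mu_lt_t)).
rewrite (tail_indicator0 mu_lt_t).
by rewrite (tail_indicator1 (lexx t)); congr EFin; lra.
Qed.

(** * The supremum *)

Lemma ereal_sup_attained (R : realType) T (F : T -> \bar R) (S : set T) (v : \bar R) :
  (exists2 x, S x & F x = v) -> (forall x, S x -> (F x <= v)%E) ->
  ereal_sup [set F x | x in S] = v.
Proof.
move=> [x Sx Fx] ub; apply/eqP; rewrite eq_le; apply/andP; split.
  by apply: ge_ereal_sup => _ [y Sy <-]; exact: ub.
by apply: ereal_sup_ubound; exists x.
Qed.

Theorem theorem3 (R : realType) (mu b d beta : R)
    (mu_gt0 : 0 < mu) (mu_lt_b : mu < b) (d_gt0 : 0 < d)
    (P_nonempty : ambiguity_set mu b d beta !=set0) :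
  0 < beta < 1 /\
  forall t : R, 0 <= t <= b ->
    ereal_sup [set P `[t, +oo[%classic | P in ambiguity_set mu b d beta]
      = (tail_bound mu d beta t)%:E.
Proof.
have [P0 HP0] := P_nonempty.
have below := half_dev_le_below HP0; have above := half_dev_le_above HP0.
have beta_gt0 : 0 < beta by nra.
have beta_lt1 : beta < 1 by nra.
have beta01 : 0 < beta < 1 by rewrite beta_gt0.
split=> // t /andP[_ tb].
have [t1E t1_itv] := tau1_spec d_gt0 beta_lt1 below.
have [t2E t2_itv] := tau2_spec d_gt0 beta_gt0 above.
have two_point := two_point_attainer beta01 t1_itv t2_itv t1E t2E.
have [/andP[t1_ge0 t1_lt_mu] /andP[mu_lt_t2 _]] := (t1_itv, t2_itv).
have tailE (P : probability (measurableTypeR R) R) :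
    P `[t, +oo[%classic = (fine (P `[t, +oo[%classic))%:E.
  by rewrite fineK ?fin_num_measure.
rewrite /tail_bound; have [t_le_t1|t1_lt_t] := lerP t (tau1 mu d beta).
  apply: ereal_sup_attained => [|P _]; last exact: probability_le1.
  have [P HP PE] := two_point; exists P => //.
  have t_le_t2 : t <= tau2 mu d beta.
    exact: le_trans t_le_t1 (ltW (lt_trans t1_lt_mu mu_lt_t2)).
  by rewrite PE (tail_indicator1 t_le_t1) (tail_indicator1 t_le_t2) !mulr1 subrK.
have [t_lt_mu|mu_le_t] := ltrP t mu.
  apply: ereal_sup_attained => [|P HP].
    by apply: below_attainer t1E t2E _ => //; rewrite t1_lt_t.
  have t_gt0 : 0 < t by exact: le_lt_trans t1_lt_t.
  rewrite tailE lee_fin -(ler_pM2l t_gt0).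
  apply: le_trans (tail_le_below HP _) _; first by rewrite t_gt0 ltW.
  by rewrite le_eqVlt; apply/orP; left; apply/eqP; field; lra.
have [t_le_t2|t2_lt_t] := lerP t (tau2 mu d beta).
  apply: ereal_sup_attained => [|P HP]; last first.
    by rewrite tailE lee_fin; exact: tail_le_beta HP mu_le_t.
  have [P HP PE] := two_point; exists P => //.
  by rewrite PE (tail_indicator0 t1_lt_t) (tail_indicator1 t_le_t2) mulr0 add0r mulr1.
apply: ereal_sup_attained => [|P HP].
  by apply: above_attainer t1E t2E _ => //; rewrite t2_lt_t.
have tmu_gt0 : 0 < t - mu by rewrite subr_gt0; exact: lt_trans t2_lt_t.
rewrite tailE lee_fin -(ler_pM2l tmu_gt0).
apply: le_trans (tail_le_above HP mu_le_t) _.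
by rewrite le_eqVlt; apply/orP; left; apply/eqP; field; lra.
Qed.
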